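(* Let $R$ be an associative unital ring and $M$ an $R$-complex. Under each of the conditions (a)–(d) below, every pure-acyclic pure subcomplex of $M$ is contractible and a split subcomplex of $M$; in particular, $M$ is split-minimal if and only if it is pure-minimal. (a) $R$ is left noetherian and $M$ is a complex of injective $R$-modules. (b) $R$ is left perfect and $M$ is a complex of projective $R$-modules. (c) $R$ is semi-perfect and $M$ is a complex of finitely generated projective $R$-modules. (d) $R$ is left noetherian and $M$ is a complex of finitely generated projective $R$-modules.
   Context: $R$-modules are left modules. An $R$-complex is a (possibly unbounded) chain complex $M$ of $R$-modules, indexed homologically; $Z_i(M)=\operatorname{Ker}(\partial_i^M)$; $\mathcal{C}(R)$ is the category of $R$-complexes and chain maps, with hom-sets $\operatorname{hom}_{\mathcal{C}(R)}(L,M)$. A complex is contractible if its identity map is null-homotopic. An exact sequence $0\to L\to M\to N\to 0$ of $R$-modules is pure if $\operatorname{Hom}_R(A,-)$ leaves it exact for every finitely presented $R$-module $A$. An exact sequence $0\to L\to M\to N\to 0$ of $R$-complexes is pure if $0\to\operatorname{hom}_{\mathcal{C}(R)}(A,L)\to\operatorname{hom}_{\mathcal{C}(R)}(A,M)\to\operatorname{hom}_{\mathcal{C}(R)}(A,N)\to 0$ is exact for every bounded complex $A$ of finitely presented $R$-modules. A subcomplex $L\subseteq M$ is pure (respectively, split) if the canonical sequence $0\to L\to M\to M/L\to 0$ is pure (respectively, split) in $\mathcal{C}(R)$; so a split subcomplex is a direct summand. An $R$-complex $M$ is pure-acyclic if it is acyclic and $0\to Z_i(M)\to M_i\to Z_{i-1}(M)\to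 0$ is a pure exact sequence of $R$-modules for every $i\in\mathbb{Z}$. An $R$-complex $M$ is split-minimal if the zero complex is the only contractible split subcomplex of $M$, and pure-minimal if the zero complex is the only pure-acyclic pure subcomplex of $M$. *)

(* Defs.v *)
From HB Require Import structures.
From mathcomp Require Import all_boot all_order all_algebra.

Set Implicit Arguments.
Unset Strict Implicit.
Unset Printing Implicit Defensive.

Import GRing.Theory.
Local Open Scope ring_scope.
Local Open Scope quotient_scope.

(** Rings are [pzRingType]s: associative and unital, the zero ring included.
    Modules are left modules, [lmodType R].  A submodule of [V] is a
    [submodClosed V]; its membership predicate is boolean, which under the
    classical axioms (excluded middle and description) allows all subsets. *)

Section SubmoduleQuotient.
Variables (R : pzRingType) (V : lmodType R).

Definition subm_type (S : submodClosed V) : Type := {x : V | x \in S}.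

Section Submodule.
Variable S : submodClosed V.

HB.instance Definition _ := SubChoice.on (subm_type S).
HB.instance Definition _ :=
  [SubChoice_isSubLmodule of subm_type S by <:].

Definition subm_incl : {linear subm_type S -> V} := \val.

(** [submodClosed] carries no closure under opposites, which [Quotient.quot]
    asks for. *)
Definition subm_pred : {pred V} := fun x => x \in S.

Fact subm_pred_zmod_closed : zmod_closed subm_pred.
Proof. exact: GRing.submod_closedB (submodClosedP S). Qed.
HB.instance Definition _ :=
  GRing.isZmodClosed.Build V subm_pred subm_pred_zmod_closed.

Definition quot_mod : Type := Quotient.quot subm_pred.
HB.instance Definition _ := GRing.Zmodule.on quot_mod.

Definition quot_pi (x : V) : quot_mod := \pi_(Quotient.quot subm_pred) x.

Definition quot_repr (q : quot_mod) : V := repr (q : Quotient.quot subm_pred).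

Lemma quot_reprK : cancel quot_repr quot_pi.
Proof. exact: reprK. Qed.

Fact quot_piD : {morph quot_pi : x y / x + y}.
Proof. exact: raddfD. Qed.

Lemma quot_piE x y : (quot_pi x == quot_pi y) = (x - y \in S).
Proof. exact/esym/(Quotient.idealrBE subm_pred). Qed.

Definition quot_scale (a : R) (q : quot_mod) : quot_mod :=
  quot_pi (a *: quot_repr q).

Lemma quot_piZ a x : quot_pi (a *: x) = quot_scale a (quot_pi x).
Proof.
by apply/eqP; rewrite quot_piE -scalerBr rpredZ // -quot_piE quot_reprK.
Qed.

Fact quot_scalerA a b q :
  quot_scale a (quot_scale b q) = quot_scale (a * b) q.
Proof. by rewrite -[q]quot_reprK -!quot_piZ scalerA. Qed.

Fact quot_scale1r : left_id 1 quot_scale.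
Proof. by move=> q; rewrite -[q]quot_reprK -quot_piZ scale1r. Qed.

Fact quot_scalerDr : right_distributive quot_scale +%R.
Proof.
move=> a p q; rewrite -[p]quot_reprK -[q]quot_reprK.
by rewrite -quot_piD -!quot_piZ scalerDr quot_piD.
Qed.

Fact quot_scalerDl q : {morph quot_scale^~ q : a b / a + b}.
Proof.
by move=> a b; rewrite -[q]quot_reprK -!quot_piZ scalerDl quot_piD.
Qed.

HB.instance Definition _ := GRing.Zmodule_isLmodule.Build R quot_mod
  quot_scalerA quot_scale1r quot_scalerDr quot_scalerDl.

Fact quot_pi_linear : linear quot_pi.
Proof. by move=> a x y; rewrite quot_piD quot_piZ. Qed.
HB.instance Definition _ :=
  GRing.isLinear.Build R V quot_mod _ quot_pi quot_pi_linear.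

End Submodule.
End SubmoduleQuotient.

Section Modules.
Variable R : pzRingType.

Section KernelAndInducedMaps.
Variables (U V : lmodType R) (f : {linear U -> V}).

Definition ker_pred : {pred U} := fun x => f x == 0.

Fact ker_submod_closed : submod_closed ker_pred.
Proof.
split=> [|a x y]; rewrite !unfold_in ?linear0 //.
by move=> /eqP fx0 /eqP fy0; rewrite linearP fx0 fy0 scaler0 addr0.
Qed.
HB.instance Definition _ :=
  GRing.isSubmodClosed.Build R U ker_pred ker_submod_closed.

Definition kernel : submodClosed U := ker_pred.

Definition corestr (T : submodClosed V) (fT : forall x, f x \in T)
  (x : U) : subm_type T := exist _ (f x) (fT x).

Fact corestr_linear T fT : linear (@corestr T fT).
Proof. by move=> a x y; apply: val_inj; rewrite /= linearP. Qed.
HB.instance Definition _ T fT :=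
  GRing.isLinear.Build R U (subm_type T) _ (@corestr T fT)
    (@corestr_linear T fT).

Variables (S : submodClosed U) (T : submodClosed V).
Hypothesis fST : forall x, x \in S -> f x \in T.

Definition sub_map (x : subm_type S) : subm_type T :=
  exist _ (f (val x)) (fST (valP x)).

Fact sub_map_linear : linear sub_map.
Proof. by move=> a x y; apply: val_inj; rewrite /= linearP. Qed.
HB.instance Definition _ := GRing.isLinear.Build R (subm_type S) (subm_type T)
  _ sub_map sub_map_linear.

(** The map is only linear because of [fST], on which it is made to depend so
    that its linear structure can be inferred. *)
Definition quot_map (q : quot_mod S) : quot_mod T :=
  let _ := fST in quot_pi T (f (quot_repr q)).

Lemma quot_map_pi x : quot_map (quot_pi S x) = quot_pi T (f x).
Proof.
by apply/eqP; rewrite /quot_map quot_piE -linearB fST // -quot_piE quot_reprK.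
Qed.

Fact quot_map_linear : linear quot_map.
Proof.
move=> a p q; rewrite -[p]quot_reprK -[q]quot_reprK.
by rewrite -linearP !quot_map_pi !linearP.
Qed.
HB.instance Definition _ := GRing.isLinear.Build R (quot_mod S) (quot_mod T)
  _ quot_map quot_map_linear.

End KernelAndInducedMaps.

Definition finitely_generated (A : lmodType R) : Prop :=
  exists (n : nat) (e : 'I_n -> A),
    forall x, exists c : 'I_n -> R, x = \sum_(i < n) c i *: e i.

(** There is an exact sequence R^m -> R^n -> A -> 0.  Row vectors carry the left
    module structure of R^n. *)
Definition finitely_presented (A : lmodType R) : Prop :=
  exists (m n : nat) (f : {linear 'rV[R]_m -> 'rV[R]_n})
         (p : {linear 'rV[R]_n -> A}),
    (forall y, p y = 0 <-> exists x, f x = y) /\ (forall z, exists y, p y = z).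

Definition projective (P : lmodType R) : Prop :=
  forall (B C : lmodType R) (g : {linear B -> C}) (f : {linear P -> C}),
    (forall c, exists b, g b = c) ->
    exists h : {linear P -> B}, forall x, g (h x) = f x.

Definition injective_module (E : lmodType R) : Prop :=
  forall (B C : lmodType R) (g : {linear B -> C}) (f : {linear B -> E}),
    injective g ->
    exists h : {linear C -> E}, forall x, h (g x) = f x.

Definition superfluous (V : lmodType R) (K : submodClosed V) : Prop :=
  forall N : submodClosed V,
    (forall x, exists y z, [/\ y \in N, z \in K & x = y + z]) ->
    forall x, x \in N.

Definition has_projective_cover (A : lmodType R) : Prop :=
  exists (P : lmodType R) (p : {linear P -> A}),
    [/\ projective P, forall a, exists x, p x = a & superfluous (kernel p)].

Definition left_noetherian : Prop :=
  forall I : nat -> submodClosed R^o,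
    (forall n, {subset I n <= I n.+1}) ->
    exists n, forall m, (n <= m)%N -> I m =i I n.

(** Perfect and semi-perfect rings in the sense of Bass. *)
Definition left_perfect : Prop :=
  forall A : lmodType R, has_projective_cover A.

Definition semi_perfect : Prop :=
  forall A : lmodType R, finitely_generated A -> has_projective_cover A.

(** Exactness of 0 -> L -f-> M -g-> N -> 0. *)
Definition short_exact (L M N : lmodType R)
    (f : {linear L -> M}) (g : {linear M -> N}) : Prop :=
  [/\ injective f,
      forall y, g y = 0 <-> exists x, f x = y
    & forall z, exists y, g y = z].

(** Exactness of 0 -> Hom(A,L) -> Hom(A,M) -> Hom(A,N) -> 0; homomorphisms are
    compared pointwise. *)
Definition hom_exact (A L M N : lmodType R)
    (f : {linear L -> M}) (g : {linear M -> N}) : Prop :=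
  [/\ forall u v : {linear A -> L}, f \o u =1 f \o v -> u =1 v,
      forall v : {linear A -> M},
        (forall x, g (v x) = 0) <-> exists u : {linear A -> L}, f \o u =1 v
    & forall w : {linear A -> N}, exists v : {linear A -> M}, g \o v =1 w].

Definition pure_exact (L M N : lmodType R)
    (f : {linear L -> M}) (g : {linear M -> N}) : Prop :=
  short_exact f g /\
  forall A : lmodType R, finitely_presented A -> hom_exact A f g.

End Modules.

Record chain_complex (R : pzRingType) := ChainComplex {
  cx_mod :> int -> lmodType R;
  diff : forall i, {linear cx_mod i -> cx_mod (i - 1)};
  diffK : forall i (x : cx_mod i), diff (i - 1) (diff i x) = 0
}.
Arguments diff {R} c i.

Section Complexes.
Variable R : pzRingType.
Implicit Types L M N A : chain_complex R.

Record chain_map L M := ChainMap {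
  cm_fun :> forall i, {linear L i -> M i};
  cm_comm : forall i (x : L i), cm_fun (i - 1) (diff L i x) = diff M i (cm_fun i x)
}.

Definition chain_id M : chain_map M M :=
  @ChainMap M M (fun i => idfun : {linear M i -> M i}) (fun i x => erefl).

(** [s i] is the component M_{i-1} -> N_i of the homotopy, and the equation
    below is the one in degree i - 1. *)
Definition null_homotopic M N (f : chain_map M N) : Prop :=
  exists s : forall i, {linear M (i - 1) -> N i},
    forall i (x : M (i - 1)),
      f (i - 1) x = diff N i (s i x) + s (i - 1) (diff M (i - 1) x).

Definition contractible M : Prop := null_homotopic (chain_id M).

Definition cx_zero M : Prop := forall i (x : M i), x = 0.

Definition bounded M : Prop :=
  exists n : nat, forall i : int, (n < `|i|)%N -> forall x : M i, x = 0.

Definition acyclic M : Prop :=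
  forall i (x : M (i - 1)), diff M (i - 1) x = 0 -> exists y, diff M i y = x.

Definition cycles M (i : int) : submodClosed (M i) := kernel (diff M i).

Fact diff_in_cycles M i (x : M i) : diff M i x \in cycles M (i - 1).
Proof. by apply/eqP; exact: diffK. Qed.

Definition diff_to_cycles M i : {linear M i -> subm_type (cycles M (i - 1))} :=
  corestr (@diff_in_cycles M i).

Definition pure_acyclic M : Prop :=
  acyclic M /\
  forall i, pure_exact (subm_incl (cycles M i)) (diff_to_cycles M i).

Definition cx_short_exact L M N (f : chain_map L M) (g : chain_map M N) : Prop :=
  forall i, short_exact (f i) (g i).

Definition cm_eq M N (f g : chain_map M N) : Prop := forall i, f i =1 g i.

(** Exactness of 0 -> hom(A,L) -> hom(A,M) -> hom(A,N) -> 0 for the groups of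
    chain maps. *)
Definition cx_hom_exact A L M N (f : chain_map L M) (g : chain_map M N) : Prop :=
  [/\ forall u v : chain_map A L,
        (forall i, f i \o u i =1 f i \o v i) -> cm_eq u v,
      forall v : chain_map A M,
        (forall i x, g i (v i x) = 0) <->
        exists u : chain_map A L, forall i, f i \o u i =1 v i
    & forall w : chain_map A N,
        exists v : chain_map A M, forall i, g i \o v i =1 w i].

Definition cx_pure_exact L M N (f : chain_map L M) (g : chain_map M N) : Prop :=
  cx_short_exact f g /\
  forall A, bounded A -> (forall i, finitely_presented (A i)) ->
    cx_hom_exact A f g.

Definition cx_split_exact L M N (f : chain_map L M) (g : chain_map M N) : Prop :=
  cx_short_exact f g /\
  exists r : chain_map M L, forall i (x : L i), r i (f i x) = x.

Record subcomplex M := Subcomplex {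
  sub_mod :> forall i, submodClosed (M i);
  sub_diff : forall i x, x \in sub_mod i -> diff M i x \in sub_mod (i - 1)
}.

Section Subcomplex.
Variables (M : chain_complex R) (L : subcomplex M).

Fact sub_cx_diffK i (x : subm_type (L i)) :
  sub_map (@sub_diff M L (i - 1)) (sub_map (@sub_diff M L i) x) = 0.
Proof. by apply: val_inj; rewrite /= diffK. Qed.

Definition sub_cx : chain_complex R :=
  @ChainComplex R (fun i => subm_type (L i))
    (fun i => sub_map (@sub_diff M L i)) sub_cx_diffK.

Fact quot_cx_diffK i (q : quot_mod (L i)) :
  quot_map (@sub_diff M L (i - 1)) (quot_map (@sub_diff M L i) q) = 0.
Proof.
by rewrite -[q]quot_reprK !quot_map_pi diffK linear0.
Qed.

Definition quot_cx : chain_complex R :=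
  @ChainComplex R (fun i => quot_mod (L i))
    (fun i => quot_map (@sub_diff M L i)) quot_cx_diffK.

Definition sub_incl : chain_map sub_cx M :=
  @ChainMap sub_cx M (fun i => subm_incl (L i)) (fun i x => erefl).

Fact quot_proj_comm i (x : M i) :
  quot_pi (L (i - 1)) (diff M i x) = diff quot_cx i (quot_pi (L i) x).
Proof. by rewrite /= quot_map_pi. Qed.

Definition quot_proj : chain_map M quot_cx :=
  @ChainMap M quot_cx (fun i => quot_pi (L i)) quot_proj_comm.

Definition pure_subcomplex : Prop := cx_pure_exact sub_incl quot_proj.

Definition split_subcomplex : Prop := cx_split_exact sub_incl quot_proj.

End Subcomplex.

Definition split_minimal M : Prop :=
  forall L : subcomplex M,
    contractible (sub_cx L) -> split_subcomplex L -> cx_zero (sub_cx L).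

Definition pure_minimal M : Prop :=
  forall L : subcomplex M,
    pure_acyclic (sub_cx L) -> pure_subcomplex L -> cx_zero (sub_cx L).

End Complexes.

(* Main.v *)
From HB Require Import structures.
Require Import Defs.
From mathcomp Require Import all_boot all_order all_algebra.
From mathcomp Require Import finmap.
From mathcomp Require Import boolp classical_sets functions fsbigop.

(** Everything reduces to modules. Suppose that the modules M_i belong to a
    class that is closed under direct summands and in which every pure exact
    sequence 0 -> K -> P -> N -> 0 with P in the class splits
    ([pure_split_class]). Maps from disc complexes show that a pure subcomplex
    L is a pure submodule in each degree ([pure_subcomplex_degree]), so L_i is
    a direct summand of M_i and belongs to the class. If L is also
    pure-acyclic, the sequences 0 -> Z_i(L) -> L_i -> Z_{i-1}(L) -> 0 are pure
    with L_i in the class, so they split and L is contractible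
    ([contractible_of_sections]). A contraction of L turns the degreewise
    retractions of M onto L into a retraction of complexes
    ([contractible_retract]). Conversely, contractible complexes are
    pure-acyclic and split subcomplexes are pure, whence the equivalence of
    the two notions of minimality.

    It remains to find the classes. Purity is used in the form that a finite
    linear system with right-hand sides in K that is solvable in P is solvable
    in K ([pure_solve]).

    (a) Over a left noetherian ring a pure submodule K of an injective module
    satisfies Baer's criterion, because ideals are finitely generated; Zorn's
    lemma then gives a retraction onto K ([pure_injective_retraction]).

    (b), (c) If P is projective and N has a projective cover, the pure
    sequence splits ([projective_cover_split]). Every element of K is fixed by
    some linear map from P to K ([pure_projective_local]); this makes every
    element of the kernel of the cover, which is superfluous, vanish, so N is
    projective. In case (b) every N has a cover, in case (c) N has one because
    it is finitely generated.

    (d) Over a left noetherian ring the finitely generated module N is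
    finitely presented, and purity lifts its identity map
    ([noetherian_fg_split]). *)

Set Implicit Arguments.
Unset Strict Implicit.
Unset Printing Implicit Defensive.

Import GRing.Theory.
Local Open Scope ring_scope.

(** * Linear maps and submodules *)

Section LinearMaps.
Variable R : pzRingType.
Implicit Types U V W K P N : lmodType R.

(** Every linear map below that is not given by a formula is obtained here: it
    is enough to describe its graph. *)
Lemma linear_choice U V (G : U -> V -> Prop) :
    (forall x, exists y, G x y) ->
    (forall x y z, G x y -> G x z -> y = z) ->
    (forall a x y x' y', G x y -> G x' y' -> G (a *: x + x') (a *: y + y')) ->
  exists f : {linear U -> V}, forall x, G x (f x).
Proof.
move=> /choice[f Gf] Gfun Glin.
have f_lin : linear f by move=> a x y; apply: Gfun (Gf _) _; apply: Glin.
pose m := GRing.isLinear.Build R U V _ f f_lin.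
by exists (HB.pack_for {linear U -> V} f m).
Qed.

Definition prop_pred V (S : V -> Prop) : {pred V} := fun x => `[< S x >].

Fact prop_pred_closed V (S : V -> Prop) : S 0 ->
  (forall a x y, S x -> S y -> S (a *: x + y)) ->
  submod_closed (prop_pred S).
Proof.
move=> S0 SL; split=> [|a x y /asboolP Sx /asboolP Sy]; apply/asboolP => //.
exact: SL.
Qed.

Definition prop_submod V (S : V -> Prop) (S0 : S 0)
    (SL : forall a x y, S x -> S y -> S (a *: x + y)) : submodClosed V :=
  HB.pack (prop_pred S)
    (GRing.isSubmodClosed.Build R V (prop_pred S) (prop_pred_closed S0 SL)).

Lemma prop_submodP V (S : V -> Prop) S0 SL x :
  reflect (S x) (x \in @prop_submod V S S0 SL).
Proof. exact: asboolP. Qed.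

Lemma image_linear U V (f : {linear U -> V}) a y z :
  (exists x, f x = y) -> (exists x, f x = z) -> exists x, f x = a *: y + z.
Proof. by move=> [x <-] [x' <-]; exists (a *: x + x'); rewrite linearP. Qed.

Lemma image0 U V (f : {linear U -> V}) : exists x, f x = 0.
Proof. by exists 0; rewrite linear0. Qed.

Definition image_submod U V (f : {linear U -> V}) : submodClosed V :=
  prop_submod (image0 f) (image_linear (f := f)).

Lemma factor_epi U V W (g : {linear U -> V}) (f : {linear U -> W}) :
    (forall y, exists x, g x = y) -> (forall x, g x = 0 -> f x = 0) ->
  exists h : {linear V -> W}, forall x, h (g x) = f x.
Proof.
move=> g_surj kerS.
have [y|y z t [x <- <-] [x' gx' <-]|a y z y' z'|h hE] :=
    linear_choice (G := fun y z => exists2 x, g x = y & f x = z).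
- by have [x gx] := g_surj y; exists (f x), x.
- apply/eqP; rewrite -subr_eq0 -linearB; apply/eqP/kerS.
  by rewrite linearB gx' subrr.
- by move=> [x <- <-] [x' <- <-]; exists (a *: x + x'); rewrite linearP.
- exists h => x; have [x' gx' <-] := hE (g x).
  apply/eqP; rewrite -subr_eq0 -linearB; apply/eqP/kerS.
  by rewrite linearB gx' subrr.
Qed.

Lemma factor_mono U V W (f : {linear V -> W}) (h : {linear U -> W}) :
    injective f -> (forall x, exists y, f y = h x) ->
  exists k : {linear U -> V}, forall x, f (k x) = h x.
Proof.
move=> f_inj imS; apply: (linear_choice (G := fun x y => f y = h x)) => //.
- by move=> x y z <- /f_inj.
- by move=> a x y x' y' fy fy'; rewrite !linearP fy fy'.
Qed.

Lemma section_of_retraction K P N (f : {linear K -> P}) (g : {linear P -> N})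
    (r : {linear P -> K}) :
  short_exact f g -> (forall x, r (f x) = x) ->
  exists s : {linear N -> P}, forall z, g (s z) = z.
Proof.
move=> [_ fg g_surj] rK.
have [x /fg[k <-]|s sE] := factor_epi (f := idfun \- (f \o r)) g_surj.
  by rewrite /= rK subrr.
exists s => z; have [y <-] := g_surj z.
rewrite sE /= linearB (_ : g (f _) = 0) ?subr0 //.
by apply/fg; eexists.
Qed.

Lemma retraction_of_section K P N (f : {linear K -> P}) (g : {linear P -> N})
    (s : {linear N -> P}) :
  short_exact f g -> (forall z, g (s z) = z) ->
  exists r : {linear P -> K}, forall x, r (f x) = x.
Proof.
move=> [f_inj fg g_surj] sK.
have [y|r rE] := factor_mono (h := idfun \- (s \o g)) f_inj.
  by apply/fg; rewrite /= linearB sK subrr.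
exists r => x; apply: f_inj; rewrite rE /=.
have -> : g (f x) = 0 by apply/fg; exists x.
by rewrite linear0 subr0.
Qed.

Lemma quot_pi_eq0 V (S : submodClosed V) x : (quot_pi S x == 0) = (x \in S).
Proof. by rewrite -[in LHS](linear0 (quot_pi S)) quot_piE subr0. Qed.

Lemma short_exact_sub_quot V (S : submodClosed V) :
  short_exact (subm_incl S) (quot_pi S).
Proof.
split=> [|y|z]; first exact: val_inj; last first.
  by exists (quot_repr z); exact: quot_reprK.
split=> [/eqP|[x <-]]; last by apply/eqP; rewrite quot_pi_eq0; exact: (valP x).
by rewrite quot_pi_eq0 => Sy; exists (exist _ y Sy).
Qed.

Definition lincomb n V (e : 'I_n -> V) (v : 'rV[R]_n) : V :=
  \sum_j v 0 j *: e j.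

Fact lincomb_linear n V (e : 'I_n -> V) : linear (lincomb e).
Proof.
move=> a u v; rewrite /lincomb scaler_sumr -big_split; apply: eq_bigr => j _.
by rewrite !mxE scalerDl scalerA.
Qed.
HB.instance Definition _ n V (e : 'I_n -> V) :=
  GRing.isLinear.Build R 'rV[R]_n V _ (lincomb e) (lincomb_linear e).

Lemma lincomb_delta n V (e : 'I_n -> V) j : lincomb e (delta_mx 0 j) = e j.
Proof.
rewrite /lincomb (bigD1 j) //= big1 => [|k kj]; last first.
  by rewrite mxE (negPf kj) andbF scale0r.
by rewrite mxE !eqxx scale1r addr0.
Qed.

Lemma linear_lincomb n U V (h : {linear U -> V}) (e : 'I_n -> U) v :
  h (lincomb e v) = lincomb (h \o e) v.
Proof. by rewrite linear_sum; apply: eq_bigr => j _; rewrite linearZ. Qed.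

Lemma row_lincomb n V (p : {linear 'rV[R]_n -> V}) v :
  p v = lincomb (fun j => p (delta_mx 0 j)) v.
Proof.
rewrite [in LHS](row_sum_delta v) linear_sum; apply: eq_bigr => j _.
by rewrite linearZ.
Qed.

End LinearMaps.

(** * Purity as solvability of linear systems *)

Section Purity.
Variable R : pzRingType.
Implicit Types A K P N Q : lmodType R.

Lemma coker_finitely_presented m n (f : {linear 'rV[R]_m -> 'rV[R]_n}) :
  finitely_presented (quot_mod (image_submod f)).
Proof.
exists m, n, f, (quot_pi (image_submod f)); split=> [y|z]; last first.
  by exists (quot_repr z); exact: quot_reprK.
split=> [/eqP|[x <-]].
  by rewrite quot_pi_eq0 => /prop_submodP.
by apply/eqP; rewrite quot_pi_eq0; apply/prop_submodP; exists x.
Qed.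

(** Let [C] be the cokernel of [A].  The unknowns [y] define a map from R^n to
    [P] whose composite with [g] kills the rows of [A], because the right-hand
    sides lie in [K]; so it induces a map from [C] to [N].  By purity the latter
    lifts to [P], which gives a solution of the homogeneous system that is
    congruent to [y] modulo [K].  The difference is the solution in [K]. *)
Lemma pure_solve K P N (f : {linear K -> P}) (g : {linear P -> N}) m n
    (A : 'M[R]_(m, n)) (y : 'I_n -> P) (k : 'I_m -> K) :
    pure_exact f g -> (forall i, \sum_j A i j *: y j = f (k i)) ->
  exists z : 'I_n -> K, forall i, \sum_j A i j *: z j = k i.
Proof.
move=> [[f_inj fg g_surj] pur] yE.
pose a := [the {linear 'rV[R]_m -> 'rV[R]_n} of mulmxr A].
have [_ _ lift] := pur _ (coker_finitely_presented a).
pose S := image_submod a.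
have [_ _ pi_surj] := short_exact_sub_quot S.
have pi0 x : quot_pi S x = 0 -> exists v, v *m A = x.
  by move=> /eqP; rewrite quot_pi_eq0 => /prop_submodP.
have yA i : lincomb y (row i A) = f (k i).
  by rewrite -yE; apply: eq_bigr => j _; rewrite mxE.
have gf x : g (f x) = 0 by apply/fg; exists x.
have [|w wE] := factor_epi (f := g \o lincomb y) pi_surj.
  move=> x /pi0[v <-]; rewrite mulmx_sum_row linear_sum big1 // => i _.
  by rewrite linearZ /= yA gf scaler0.
have [v vE] := lift w.
pose z j := y j - v (quot_pi S (delta_mx 0 j)).
have imz j : exists t, f t = z j.
  apply/fg; rewrite linearB -[g (v _)]/((g \o v) _) vE wE /=.
  by rewrite lincomb_delta subrr.
have [t tE] := choice imz.
exists t => i; apply: f_inj; rewrite linear_sum -yE.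
have vA : v (quot_pi S (row i A)) = 0.
  rewrite (_ : quot_pi S _ = 0) ?linear0 //; apply/eqP; rewrite quot_pi_eq0.
  by apply/prop_submodP; exists (delta_mx 0 i); rewrite /= -rowE.
rewrite -[RHS]subr0 -[X in _ = _ - X]vA -[v _]/((v \o quot_pi S) _).
rewrite row_lincomb /lincomb -sumrB.
by apply: eq_bigr => j _; rewrite linearZ tE /z mxE /= -scalerBr.
Qed.

Lemma split_pure_exact K P N (f : {linear K -> P}) (g : {linear P -> N})
    (s : {linear N -> P}) :
  short_exact f g -> (forall z, g (s z) = z) -> pure_exact f g.
Proof.
move=> fg_ex sK; split=> // A _; have [f_inj fg _] := fg_ex; split.
- by move=> u v fuv x; exact/f_inj/fuv.
- move=> v; split=> [gv0|[u fu] x]; last by apply/fg; exists (u x); exact: fu.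
  by have [x|u uE] := factor_mono (h := v) f_inj; [exact/fg|exists u].
- by move=> w; exists (s \o w) => x /=; rewrite sK.
Qed.

(** * Projective modules *)

Section FreeModule.
Variable T : lmodType R.

(** The free module on the set [T] is encoded as a submodule of the functions
    from [T] to the regular module. *)
Definition finsupp_fun (c : T -> R^o) : Prop :=
  exists A : {fset T}, forall y, y \notin A -> c y = 0.

Fact finsupp_fun0 : finsupp_fun 0.
Proof. by exists fset0. Qed.

Fact finsupp_funP a c d :
  finsupp_fun c -> finsupp_fun d -> finsupp_fun (a *: c + d).
Proof.
move=> [A cA] [B dB]; exists (A `|` B)%fset => y.
rewrite in_fsetU negb_or => /andP[/cA cy /dB dy].
by rewrite -[LHS]/(a *: c y + d y) cy dy scaler0 addr0.
Qed.

Definition free_mod : lmodType R :=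
  subm_type (prop_submod finsupp_fun0 finsupp_funP).

Definition free_eval (c : free_mod) : T :=
  \sum_(y \in [set: T]) (val c y : R) *: y.

Fact free_eval_linear : linear free_eval.
Proof.
move=> a [c Sc] [d Sd]; rewrite /free_eval /=.
have /prop_submodP[A cA] := Sc; have /prop_submodP[B dB] := Sd.
have cE y : y \notin (A `|` B)%fset -> (c y : R) *: y = 0.
  by rewrite in_fsetU negb_or => /andP[/cA-> _]; rewrite scale0r.
have dE y : y \notin (A `|` B)%fset -> (d y : R) *: y = 0.
  by rewrite in_fsetU negb_or => /andP[_ /dB->]; rewrite scale0r.
have cdE y :
      ((a *: c + d) y : R) *: y = a *: ((c y : R) *: y) + (d y : R) *: y.
  by rewrite -[(_ + _) y]/(a * c y + d y) scalerDl scalerA.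
rewrite !(fsbigTE (A `|` B)%fset) //; last first.
  by move=> y yAB; rewrite cdE cE ?dE // scaler0 addr0.
by rewrite scaler_sumr -big_split; apply: eq_bigr => y _; rewrite cdE.
Qed.
HB.instance Definition _ :=
  GRing.isLinear.Build R free_mod T _ free_eval free_eval_linear.

Lemma free_eval_surj t : exists c, free_eval c = t.
Proof.
pose c : T -> R^o := fun y => if y == t then 1 else 0.
have Sc : c \in prop_submod finsupp_fun0 finsupp_funP.
  apply/prop_submodP; exists [fset t]%fset => y.
  by rewrite in_fset1 /c => /negPf->.
exists (exist _ c Sc); rewrite /free_eval (fsbigTE [fset t]%fset) /=.
  by rewrite big_seq_fset1 /c eqxx scale1r.
by move=> y; rewrite in_fset1 /c => /negPf->; rewrite scale0r.
Qed.

End FreeModule.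

(** Coordinates with respect to the canonical generators of the free module on
    the set [P], of which [P] is a direct summand.  Only finitely many of them
    matter for the given [x]. *)
Lemma projective_dual_basis P (x : P) : projective P ->
  exists n (e : 'I_n -> P) (phi : {linear P -> 'rV[R]_n}),
    x = lincomb e (phi x).
Proof.
move=> /(_ _ _ (@free_eval P) idfun (@free_eval_surj P))[h hE].
have [A hxA] := elimT (prop_submodP _ _ _) (valP (h x)).
pose phi (y : P) : 'rV[R]_#|` A| := \row_j val (h y) (tnth (in_tuple A) j).
have phi_lin : linear phi.
  by move=> a y z; apply/rowP => j; rewrite !mxE (linearP h).
pose m := GRing.isLinear.Build R _ _ _ phi phi_lin.
exists #|` A|, (tnth (in_tuple A)).
exists (HB.pack_for {linear P -> 'rV[R]_#|` A|} phi m).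
rewrite -[LHS](hE x) /= /free_eval (fsbigTE A) => [|y /hxA->]; last first.
  by rewrite scale0r.
by rewrite big_tnth; apply: eq_bigr => j _; rewrite mxE.
Qed.

(** The expansion of [f k] in a dual basis is a linear equation, with one row,
    that the basis vectors solve in [P].  Replacing them by a solution in [K]
    turns the expansion of the identity into the map [h].  This is a theorem of
    Villamayor. *)
Lemma pure_projective_local K P N (f : {linear K -> P}) (g : {linear P -> N})
    (k : K) :
    projective P -> pure_exact f g ->
  exists h : {linear P -> K}, h (f k) = k.
Proof.
move=> /projective_dual_basis - /(_ (f k))[n [e [phi fk]]] fg_pure.
have [|z zE] := pure_solve (A := phi (f k)) (y := e) (k := fun=> k) fg_pure.
  by move=> i; rewrite ord1 [RHS]fk.
by exists (lincomb z \o phi); rewrite /= -[RHS](zE 0).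
Qed.

(** A projective cover [p : Q -> N] is injective, so that [N] is projective.
    Comparison maps [u : Q -> P] and [v : P -> Q] exist over [N].  For [x] in
    ker p the element [u x] lies in [K], hence is fixed by some [h : P -> K].
    The endomorphism [phi = v u - v h u] of [Q] kills [x] and is the identity
    modulo the superfluous submodule ker p.  Therefore it is onto, hence has a
    section [t], and [t] is again the identity modulo ker p, hence onto.  Thus
    [phi] is bijective and [x = 0]. *)
Lemma projective_cover_split K P N (f : {linear K -> P})
    (g : {linear P -> N}) :
    projective P -> has_projective_cover N -> pure_exact f g ->
  exists s : {linear N -> P}, forall z, g (s z) = z.
Proof.
move=> P_proj [Q [p [Q_proj p_surj p_sup]]] fg_pure.
have [[f_inj fg g_surj] _] := fg_pure.
have [u uE] := Q_proj _ _ g p g_surj; have [v vE] := P_proj _ _ p g p_surj.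
suff p_inj x : p x = 0 -> x = 0.
  have [x px0|s sE] := factor_epi (g := p) (f := u) p_surj.
    by rewrite (p_inj x) // linear0.
  by exists s => z; have [x <-] := p_surj z; rewrite sE uE.
move=> px0; have [k kE] : exists k, f k = u x by apply/fg; rewrite uE.
have [h hk] := pure_projective_local k P_proj fg_pure.
pose phi : {linear Q -> Q} := (v \o u) \- (v \o (f \o (h \o u))).
have pphi y : p (phi y) = p y.
  rewrite /= linearB /= !vE uE (_ : g (f _) = 0) ?subr0 //.
  by apply/fg; eexists.
have phix : phi x = 0 by rewrite /= -kE hk subrr.
have phi_surj y : exists z, phi z = y.
  apply/(prop_submodP (image0 phi) (image_linear (f := phi))).
  move: y; apply: p_sup => y; exists (phi y), (y - phi y); split.
  - by apply/prop_submodP; exists y.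
  - by apply/eqP; rewrite linearB pphi subrr.
  - by rewrite addrC subrK.
have [t tE] := Q_proj _ _ phi idfun phi_surj.
have t_surj y : exists z, t z = y.
  apply/(prop_submodP (image0 t) (image_linear (f := t))).
  move: y; apply: p_sup => y; exists (t (phi y)), (y - t (phi y)); split.
  - by apply/prop_submodP; exists (phi y).
  - by apply/eqP; rewrite linearB -(pphi (t _)) tE pphi subrr.
  - by rewrite addrC subrK.
have [y ty] := t_surj x.
by rewrite -ty -[y](tE y) ty phix linear0.
Qed.

End Purity.

(** * Noetherian rings *)

Section Span.
Variable R : pzRingType.
Implicit Types U V K P N : lmodType R.

(** Linear combinations of a list are built up one vector at a time, so that
    concatenation and passage to images are proved by induction. *)
Fixpoint span V (s : seq V) (x : V) : Prop :=
  if s is a :: s' then exists c y, span s' y /\ x = c *: a + y else x = 0.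

Lemma span0 V (s : seq V) : span s 0.
Proof.
by elim: s => //= a s IHs; exists 0, 0; split=> //; rewrite scale0r addr0.
Qed.

Lemma spanP V (s : seq V) a x y : span s x -> span s y -> span s (a *: x + y).
Proof.
elim: s x y => [|b s IHs] x y /=.
  by move=> -> ->; rewrite scaler0 addr0.
move=> [c [x' [sx' ->]]] [d [y' [sy' ->]]].
exists (a * c + d), (a *: x' + y'); split; first exact: IHs.
by rewrite scalerDl scalerDr scalerA addrACA.
Qed.

Lemma span_sub V (s : seq V) a x : span s x -> span (a :: s) x.
Proof. by move=> sx; exists 0, x; rewrite scale0r add0r. Qed.

Lemma span_cat V (s t : seq V) x y :
  span s x -> span t y -> span (s ++ t) (x + y).
Proof.
elim: s x => [|b s IHs] x /=; first by move=> -> ty; rewrite add0r.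
move=> [c [x' [sx' ->]]] ty; exists c, (x' + y); rewrite addrA; split=> //.
exact: IHs.
Qed.

Lemma span_map U V (f : {linear U -> V}) s z :
  span (map f s) z -> exists2 y, span s y & f y = z.
Proof.
elim: s z => [|b s IHs] z /=; first by move=> ->; exists 0; rewrite ?linear0.
move=> [c [_ [/IHs[y sy <-] ->]]]; exists (c *: b + y); last by rewrite linearP.
by exists c, y.
Qed.

Lemma span_lincomb V (s : seq V) x :
  span s x -> exists v, x = lincomb (fun i : 'I_(size s) => s`_i) v.
Proof.
elim: s x => [|b s IHs] x /=; first by move=> ->; exists 0; rewrite linear0.
move=> [c [y [/IHs[v ->] ->]]].
exists (\row_i if unlift 0 i is Some j then v 0 j else c).
rewrite /lincomb big_ord_recl !mxE unlift_none; congr (_ + _).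
by apply: eq_bigr => j _; rewrite !mxE liftK.
Qed.

Definition fg_set V (S : V -> Prop) : Prop :=
  exists2 s : seq V, forall y, y \in s -> S y & forall x, S x -> span s x.

Lemma span_set V (S : V -> Prop) s x : S 0 ->
    (forall a x y, S x -> S y -> S (a *: x + y)) ->
  (forall y, y \in s -> S y) -> span s x -> S x.
Proof.
move=> S0 SP; elim: s x => [|b s IHs] x sS /=; first by move=> ->.
move=> [c [y [sy ->]]]; apply: SP; first by apply: sS; rewrite mem_head.
by apply: IHs sy => z zs; apply: sS; rewrite in_cons zs orbT.
Qed.

(** Otherwise a vector outside the span can always be added to a finite list in
    [S], and the spans form a chain that never becomes stationary. *)
Lemma noetherian_ideal_fg (S : R^o -> Prop) : left_noetherian R ->
  S 0 -> (forall a x y, S x -> S y -> S (a *: x + y)) -> fg_set S.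
Proof.
move=> noeth S0 SP; apply: contrapT => notfg.
have next s : exists x, (forall y, y \in s -> S y) -> S x /\ ~ span s x.
  apply: contrapT => noext; apply: notfg.
  have [sS|] := pselect (forall y, y \in s -> S y); last first.
    by move=> nsS; case: noext; exists 0.
  exists s => // x Sx; apply: contrapT => nsx.
  by apply: noext; exists x.
have [ext extE] := choice next.
pose s := fix s n := if n is n'.+1 then ext (s n') :: s n' else [::].
have sS n : forall y, y \in s n -> S y.
  elim: n => //= n IHn y; rewrite in_cons => /predU1P[->|/IHn//].
  by have [] := extE _ IHn.
pose I n := prop_submod (span0 (s n)) (@spanP _ (s n)).
have [n /(_ n.+1 (leqnSn n)) In] : exists n, forall m, (n <= m)%N -> I m =i I n.
  by apply: noeth => n x /prop_submodP sx; apply/prop_submodP; apply: span_sub.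
have [_] := extE _ (sS n); apply.
apply/(prop_submodP (span0 (s n)) (@spanP _ (s n))); rewrite -[_ \in _]In.
apply/prop_submodP; exists 1, 0; split; first exact: span0.
by rewrite scale1r addr0.
Qed.

Lemma lift_seq U V (f : {linear U -> V}) (S : U -> Prop) (s : seq V) :
    (forall y, y \in s -> exists2 x, S x & f x = y) ->
  exists2 t : seq U, forall x, x \in t -> S x & map f t = s.
Proof.
elim: s => [|b s IHs] sS; first by exists [::].
have [|t tS <-] := IHs; first by move=> y ys; apply: sS; rewrite in_cons ys orbT.
have [x Sx fx] := sS b (mem_head _ _).
exists (x :: t); last by rewrite /= fx.
by move=> y; rewrite in_cons => /predU1P[->|/tS].
Qed.

(** Lifts of generators of the ideal f(S), together with generators of the part
    of [S] on which [f] vanishes, generate [S]. *)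
Lemma fg_set_ext V (f : {linear V -> R^o}) (S : V -> Prop) :
    left_noetherian R ->
    S 0 -> (forall a x y, S x -> S y -> S (a *: x + y)) ->
  fg_set (fun x => S x /\ f x = 0) -> fg_set S.
Proof.
move=> noeth S0 SP [s sS sgen].
have [|a x y [x' Sx <-] [y' Sy <-]|_ /lift_seq[t tS <-] tgen] :=
    noetherian_ideal_fg (S := fun y => exists2 x, S x & f x = y) noeth.
- by exists 0; rewrite ?linear0.
- by exists (a *: x' + y'); [exact: SP|rewrite linearP].
exists (t ++ s) => [y|x Sx]; first by rewrite mem_cat => /orP[/tS|/sS[]].
have [|y ty fy] := @span_map _ _ f t (f x); first by apply: tgen; exists x.
have Sy := span_set S0 SP tS ty.
rewrite -[x](subrK y) addrC; apply: span_cat => //; apply: sgen; split.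
  by rewrite addrC -scaleN1r; apply: SP.
by rewrite linearB fy subrr.
Qed.

(** The submodules of [S] in which the first k coordinates vanish are treated by
    descending induction on k, one coordinate being removed at each step. *)
Lemma noetherian_row_fg n (S : 'rV[R]_n -> Prop) : left_noetherian R ->
  S 0 -> (forall a x y, S x -> S y -> S (a *: x + y)) -> fg_set S.
Proof.
move=> noeth S0 SP.
pose T k x := S x /\ forall j : 'I_n, (j < k)%N -> x 0 j = 0.
have T0 k : T k 0 by split=> // j _; rewrite mxE.
have TP k a x y : T k x -> T k y -> T k (a *: x + y).
  move=> [Sx x0] [Sy y0]; split=> [|j jk]; first exact: SP.
  by rewrite !mxE x0 ?y0 // mulr0 addr0.
suff fgT k : (k <= n)%N -> fg_set (T (n - k)%N).
  have [s sS sgen] := fgT n (leqnn n); exists s => [y /sS[]//|x Sx].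
  by apply: sgen; split=> // j; rewrite subnn.
elim: k => [_|k IHk kn].
  exists [::] => // x [_ x0]; rewrite /=; apply/rowP => j; rewrite mxE x0 //.
  by rewrite subn0.
have nk : (n - k.+1 < n)%N by rewrite subnSK // leq_subr.
pose c (x : 'rV[R]_n) : R^o := x 0 (Ordinal nk).
have c_lin : linear c by move=> a x y; rewrite /c !mxE.
pose f := HB.pack_for {linear 'rV[R]_n -> R^o} c
  (GRing.isLinear.Build R _ _ _ c c_lin).
apply: (fg_set_ext (f := f)) => //; first exact: TP.
have [s sS sgen] := IHk (ltnW kn); exists s => [y /sS|x [[Sx x0] cx]].
  move=> [Sy y0]; split; last by apply: y0; rewrite /= subnSK.
  by split=> // j jk; apply: y0; rewrite -(subnSK kn) ltnW.
apply: sgen; split=> // j; rewrite -(subnSK kn) ltnS leq_eqVlt.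
case/orP => [/eqP jk|/x0//].
by rewrite -cx /= /c; congr (x 0 _); apply: val_inj.
Qed.

Lemma noetherian_fg_fp V :
  left_noetherian R -> finitely_generated V -> finitely_presented V.
Proof.
move=> noeth [n [e eV]].
have [||s sS sgen] := noetherian_row_fg (S := fun v => lincomb e v = 0) noeth.
- by rewrite linear0.
- by move=> a x y ex ey; rewrite linearP /= ex ey scaler0 addr0.
exists (size s), n, (lincomb (fun i : 'I_(size s) => s`_i)), (lincomb e).
split=> [v|x]; last first.
  have [c ->] := eV x; exists (\row_i c i).
  by apply: eq_bigr => i _; rewrite mxE.
split=> [/sgen/span_lincomb[c ->]|[c <-]]; first by exists c.
rewrite (linear_lincomb (lincomb e)) /lincomb big1 // => i _.
by rewrite /= sS ?mem_nth // scaler0.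
Qed.

(** Since [N] is finitely presented, purity lifts its identity map. *)
Lemma noetherian_fg_split K P N (f : {linear K -> P}) (g : {linear P -> N}) :
    left_noetherian R -> finitely_generated N -> pure_exact f g ->
  exists s : {linear N -> P}, forall z, g (s z) = z.
Proof.
move=> noeth /(noetherian_fg_fp noeth) fpN [_ /(_ N fpN)[_ _]].
by move=> /(_ idfun)[s sE]; exists s.
Qed.

(** * Pure submodules of injective modules *)

(** Baer's criterion for [K], with a linear map from an ideal to [K] given by its
    graph [G].  Followed by [f] the map extends to R, so it is multiplication by
    an element of [P].  On finitely many generators of the ideal this says that
    a linear system in one unknown with right-hand sides in [K] is solvable in
    [P]; by purity it is solvable in [K]. *)
Lemma pure_injective_baer K P N (f : {linear K -> P}) (g : {linear P -> N})
    (G : R^o -> K -> Prop) :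
    left_noetherian R -> injective_module P -> pure_exact f g ->
    G 0 0 -> (forall r y z, G r y -> G r z -> y = z) ->
    (forall a r y r' y', G r y -> G r' y' -> G (a *: r + r') (a *: y + y')) ->
  exists k, forall r y, G r y -> y = (r : R) *: k.
Proof.
move=> noeth P_inj fg_pure G0 Gfun Glin.
pose I r := exists y, G r y.
have I0 : I 0 by exists 0.
have IP a r r' : I r -> I r' -> I (a *: r + r').
  by move=> [y Gy] [y' Gy']; exists (a *: y + y'); exact: Glin.
have [s sI sgen] := noetherian_ideal_fg noeth I0 IP.
pose J := prop_submod I0 IP.
have JI (r : subm_type J) : I (val r) by apply/(prop_submodP I0 IP)/(valP r).
have [r|r z z' [y Gy <-] [y' Gy' <-]|a r z r' z' [y Gy <-] [y' Gy' <-]|h hE] :=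
  linear_choice (G := fun (r : subm_type J) z =>
    exists2 y, G (val r) y & f y = z).
- by have [y Gy] := JI r; exists (f y), y.
- by rewrite (Gfun _ _ _ Gy Gy').
- by exists (a *: y + y'); [exact: Glin|rewrite linearP].
have [|m mE] := P_inj _ _ (subm_incl J) h; first exact: val_inj.
have sG r : exists y, r \in s -> G r y.
  have [/sI[y Gy]|_] := boolP (r \in s); last by exists 0.
  by exists y.
have [k kE] := choice sG.
pose m1 : P := m (1 : R^o).
have [|z zE] := pure_solve (A := (\matrix_(i, j) (s`_i : R)) : 'M[R]_(size s, 1))
    (y := fun=> m1) (k := fun i => k s`_i) fg_pure.
  move=> i; rewrite big_ord1 mxE.
  have Ji : s`_i \in J by apply/prop_submodP/sI/mem_nth.
  have [y Gy fy] := hE (exist _ s`_i Ji).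
  have -> : (s`_i : R) *: m1 = m (subm_incl J (exist _ s`_i Ji)).
    by rewrite -linearZ; congr (m _); rewrite /= -[LHS]/(s`_i * 1) mulr1.
  by rewrite mE -fy; congr (f _); apply: Gfun Gy (kE _ (mem_nth _ _)).
exists (z 0) => r y Gy; apply: (Gfun _ _ _ Gy).
have : span s r by apply: sgen; exists y.
apply: (span_set (S := fun r : R^o => G r ((r : R) *: z 0))).
- by rewrite scale0r.
- by move=> a t t' Gt Gt'; rewrite scalerDl -scalerA; apply: Glin.
move=> t ts; have := kE t ts.
have tlt : (index t s < size s)%N by rewrite index_mem.
by have := zE (Ordinal tlt); rewrite big_ord1 mxE /= nth_index // => <-.
Qed.

(** Zorn's lemma yields a maximal graph [X] of a linear map to [K] defined on a
    submodule of [P] that contains [K].  By Baer's criterion it extends to any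
    further element, so it is defined on all of [P]. That a graph is the
    identity on [K] is expressed by invariance under translation by the
    pairs (f k, k), a condition that also the empty set, the union of the
    empty chain, satisfies. *)
Lemma pure_injective_retraction K P N (f : {linear K -> P})
    (g : {linear P -> N}) :
    left_noetherian R -> injective_module P -> pure_exact f g ->
  exists r : {linear P -> K}, forall k, r (f k) = k.
Proof.
move=> noeth P_inj fg_pure; have [[f_inj fg g_surj] _] := fg_pure.
pose lin (X : set (P * K)) := forall a x y x' y',
  X (x, y) -> X (x', y') -> X (a *: x + x', a *: y + y').
pose fct (X : set (P * K)) := forall x y y', X (x, y) -> X (x, y') -> y = y'.
pose ext (X : set (P * K)) := forall x y k, X (x, y) -> X (x + f k, y + k).
have [F FP Ftot|X [[Xlin Xfct Xext] Xmax]] :=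
    @Zorn_bigcup (P * K) (fun X => [/\ lin X, fct X & ext X]).
  split=> [a x y x' y'|x y y'|x y k].
  - move=> [X FX Xxy] [Y FY Yxy]; have [XY|YX] := Ftot _ _ FX FY.
      by exists Y => //; have [Ylin _ _] := FP _ FY; apply: Ylin => //; exact: XY.
    by exists X => //; have [Xlin _ _] := FP _ FX; apply: Xlin => //; exact: YX.
  - move=> [X FX Xxy] [Y FY Yxy]; have [XY|YX] := Ftot _ _ FX FY.
      by have [_ Yfct _] := FP _ FY; apply: Yfct Yxy; exact: XY.
    by have [_ Xfct _] := FP _ FX; apply: (Xfct _ _ _ Xxy); exact: YX.
  - by move=> [X FX Xxy]; exists X => //; have [_ _ Xext] := FP _ FX; exact: Xext.
(* The empty set is not maximal: it lies below the graph of the identity of K. *)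
have X0 : X (0, 0).
  have [[[x y] Xxy]|X0] := pselect (X !=set0)%classic.
    have := Xlin (-1) _ _ _ _ Xxy Xxy.
    by rewrite !scaleN1r !addNr.
  case: (Xmax [set p | p.1 = f p.2]%classic).
    split=> [[x y] Xxy|/(_ (0, 0)) /= sub]; first by case: X0; exists (x, y).
    by case: X0; exists (0, 0); apply: sub; rewrite linear0.
  split=> [a x y x' y' /= -> ->|x y y' /= -> /f_inj//|x y k /= ->].
    by rewrite linearP.
  by rewrite linearD.
have Xf k : X (f k, k) by have := Xext _ _ k X0; rewrite !add0r.
suff Xtot x : exists y, X (x, y).
  have [r rE] := linear_choice Xtot Xfct Xlin.
  by exists r => k; apply: Xfct (rE _) (Xf k).
have [|r y y'|a r y r' y'|k kE] := pure_injective_baer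
    (G := fun r y => X ((r : R) *: x, y)) noeth P_inj fg_pure.
- by rewrite scale0r.
- exact: Xfct.
- by move=> Xy Xy'; rewrite scalerDl -scalerA; apply: Xlin.
(* The witness is the graph of the extension to x that sends x to k. *)
apply: contrapT => nx; apply: (Xmax
  [set p | exists r y, X (p.1 - r *: x, y) /\ p.2 = y + r *: k]%classic).
  split=> [[x' y'] Xxy|sub] /=.
    by exists 0, y'; rewrite !scale0r subr0 addr0.
  apply: nx; exists k; apply: sub => /=.
  by exists 1, 0; rewrite !scale1r subrr add0r.
split=> [a x1 y1 x2 y2|x1 y1 y2|x1 y1 k1] /=.
- move=> [r [y [Xy ->]]] [r' [y' [Xy' ->]]].
  exists (a * r + r'), (a *: y + y'); split.
    have -> : a *: x1 + x2 - (a * r + r') *: x =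
      a *: (x1 - r *: x) + (x2 - r' *: x).
      by rewrite scalerBr scalerDl opprD addrACA scalerA.
    exact: Xlin.
  by rewrite scalerDr scalerDl addrACA scalerA.
- move=> [r [y [Xy ->]]] [r' [y' [Xy' ->]]].
  have /kE : X ((r' - r) *: x, y - y').
    have := Xlin (-1) _ _ _ _ Xy' Xy; rewrite !scaleN1r [- y' + y]addrC.
    by rewrite opprB addrA subrK scalerBl.
  rewrite scalerBl => /eqP; rewrite subr_eq addrAC => /eqP ->.
  by rewrite subrK addrC.
- move=> [r [y [Xy ->]]]; exists r, (y + k1).
  by rewrite addrAC [y + _ + _]addrAC; split=> //; apply: Xext.
Qed.
End Span.

(** * Disc complexes and purity in each degree *)

Section Disc.
Variable R : pzRingType.
Implicit Types A V W : lmodType R.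

(** Modules and maps of a disc depend only on booleans that tell whether a degree
    lies in it, so its differential involves no transport along equalities of
    degrees. *)
Definition disc_mod A (b : bool) : lmodType R := if b then A else 'rV[R]_0.

Definition disc_in A (b : bool) : {linear A -> disc_mod A b} :=
  if b return {linear A -> disc_mod A b} then idfun else \0.

Definition disc_out A V (b : bool) (h : {linear A -> V}) :
    {linear disc_mod A b -> V} :=
  if b return {linear disc_mod A b -> V} then h else \0.

Definition disc_diff A (b b' : bool) : {linear disc_mod A b -> disc_mod A b'} :=
  disc_out b (disc_in A b').

Lemma disc_out_in A V (b : bool) (h : {linear A -> V}) x :
  b -> disc_out b h (disc_in A b x) = h x.
Proof. by case: b. Qed.

Lemma disc_out_diff A V (b b' : bool) (h h' : {linear A -> V}) x :
  b' -> h =1 h' -> disc_out b' h (disc_diff A b b' x) = disc_out b h' x.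
Proof. by case: b' => // _ hh'; case: b x => x //=; rewrite linear0. Qed.

Lemma disc_out_comp A V W (b : bool) (h : {linear A -> V})
    (d : {linear V -> W}) x :
  d (disc_out b h x) = disc_out b (d \o h) x.
Proof. by case: b x => x //=; rewrite linear0. Qed.

Lemma disc_out0 A V (b : bool) (h : {linear A -> V}) x :
  (b -> forall y, h y = 0) -> disc_out b h x = 0.
Proof. by case: b x => //= x; apply. Qed.

Variables (i : int) (A : lmodType R).

Definition in_disc (j : int) : bool := (j == i) || (j == i - 1).

(** The disc is [A] in the degrees [i] and [i - 1] with the identity as
    differential.  Chain maps from it to [Q] are linear maps from [A] to
    [Q i]. *)
Definition disc_cx_diff j :
    {linear disc_mod A (in_disc j) -> disc_mod A (in_disc (j - 1))} :=
  if j == i then disc_diff A (in_disc j) (in_disc (j - 1)) else \0.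

Lemma subr1_neq (j : int) : j - 1 == j = false.
Proof. by rewrite -subr_eq0 addrAC subrr. Qed.

Fact disc_diffK j x : disc_cx_diff (j - 1) (disc_cx_diff j x) = 0.
Proof.
rewrite /disc_cx_diff; have [ji|_] := eqVneq j i; last exact: linear0.
by rewrite -{1}ji subr1_neq.
Qed.

Definition disc : chain_complex R := ChainComplex disc_diffK.

Lemma disc_bounded : bounded disc.
Proof.
exists (maxn `|i| `|i - 1|) => j; rewrite gtn_max => /andP[ji ji1] /=.
have /negPf-> : ~~ in_disc j.
  by apply/negP => /orP[]/eqP jE; [move: ji|move: ji1]; rewrite jE ltnn.
by move=> x; apply/rowP => -[].
Qed.

Lemma disc_finitely_presented :
  finitely_presented A -> forall j, finitely_presented (disc j).
Proof.
move=> fpA j /=; case: in_disc => //.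
exists 0, 0, \0, idfun; split=> [y|z]; last by exists z.
by split=> _; [exists 0|]; apply/rowP => -[].
Qed.

Variables (Q : chain_complex R) (w : {linear A -> Q i}).

Definition disc_component j : {linear A -> Q j} :=
  match j =P i, j =P i - 1 with
  | ReflectT e, _ => eq_rect i (fun k => {linear A -> Q k}) w j (esym e)
  | _, ReflectT e =>
      eq_rect (i - 1) (fun k => {linear A -> Q k}) (diff Q i \o w) j (esym e)
  | _, _ => \0
  end.

Lemma disc_component_top : disc_component i = w.
Proof.
rewrite /disc_component; case: (i =P i) => // e.
by rewrite (eq_irrelevance e erefl).
Qed.

Lemma disc_component_bot : disc_component (i - 1) = diff Q i \o w.
Proof.
rewrite /disc_component; case: (i - 1 =P i) => [e|_].
  by case/eqP: (negbT (subr1_neq i)).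
by case: (i - 1 =P i - 1) => // e; rewrite (eq_irrelevance e erefl).
Qed.

Fact disc_map_comm j (x : disc j) :
  disc_out (in_disc (j - 1)) (disc_component (j - 1)) (diff disc j x) =
  diff Q j (disc_out (in_disc j) (disc_component j) x).
Proof.
rewrite disc_out_comp /= /disc_cx_diff; case: (j =P i) => [ji|ji].
  subst j.
  apply: disc_out_diff => [|y]; first by rewrite /in_disc eqxx orbT.
  by rewrite disc_component_bot /= disc_component_top.
rewrite linear0; apply/esym/disc_out0 => /orP[/eqP//|/eqP-> y].
by rewrite /= disc_component_bot /= diffK.
Qed.

Definition disc_map : chain_map disc Q := ChainMap disc_map_comm.

End Disc.

Section Complexes.
Variable R : pzRingType.
Implicit Types K P N : lmodType R.

(** A linear map from [A] to the quotient in degree [i] is a chain map from a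
    disc, which lifts because the disc is bounded. *)
Lemma pure_subcomplex_degree (M : chain_complex R) (L : subcomplex M) i :
  pure_subcomplex L -> pure_exact (subm_incl (L i)) (quot_pi (L i)).
Proof.
move=> [_ pur]; have SQ := short_exact_sub_quot (L i); have [f_inj fg _] := SQ.
split=> // A fpA; split.
- by move=> u v fuv x; exact/f_inj/fuv.
- move=> v; split=> [gv0|[u fu] x]; last by apply/fg; exists (u x); exact: fu.
  by have [x|u uE] := factor_mono (h := v) f_inj; [exact/fg|exists u].
move=> w; pose D := disc i A.
have [_ _] := pur D (disc_bounded i A) (disc_finitely_presented i fpA).
move=> /(_ (disc_map (Q := quot_cx L) w))[v vE].
have ii : in_disc i i by rewrite /in_disc eqxx.
exists (v i \o disc_in A (in_disc i i)) => x.
rewrite -[LHS]/((quot_proj L i \o v i) (disc_in A (in_disc i i) x)) vE /=.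
by rewrite disc_out_in // disc_component_top.
Qed.

(** * Contractible complexes *)

(** The homotopy is the projection of N_{i-1} onto its cycles along the chosen
    complement, followed by the section. *)
Lemma contractible_of_sections (N : chain_complex R) :
    (forall i, exists s : {linear subm_type (cycles N (i - 1)) -> N i},
      forall z, diff_to_cycles N i (s z) = z) ->
  contractible N.
Proof.
move=> sec; have [s sE] := all_sig (fun i => cid (sec i)).
have dK i z : diff N i (s i z) = val z by rewrite -[in RHS](sE i z).
have cyc i : exists p : {linear N i -> subm_type (cycles N i)},
    forall x, val (p x) = x - s i (diff_to_cycles N i x).
  apply: (factor_mono (f := subm_incl (cycles N i))
    (h := idfun \- (s i \o diff_to_cycles N i))); first exact: val_inj.
  move=> x; have px : x - s i (diff_to_cycles N i x) \in cycles N i.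
    by apply/eqP; rewrite linearB dK subrr.
  by exists (exist (fun y => y \in cycles N i) _ px).
have [p pE] := all_sig (fun i => cid (cyc i)).
exists (fun i => s i \o p (i - 1)) => i x /=.
rewrite dK pE -[LHS](subrK (s (i - 1) (diff_to_cycles N (i - 1) x))).
congr (_ + s _ _); apply: val_inj; rewrite pE /=.
have -> : diff_to_cycles N (i - 1 - 1) (diff N (i - 1) x) = 0.
  by apply: val_inj; rewrite /= diffK.
by rewrite linear0 subr0.
Qed.

(** A homotopy has components indexed by [i - 1], a chain map has components
    indexed by [i]; this lemma reindexes. *)
Lemma shift_family (P : int -> Type) (t : forall i, P (i - 1)) :
  {r : forall i, P i | forall i, r (i - 1) = t i}.
Proof.
exists (fun i => eq_rect (i + 1 - 1) P (t (i + 1)) i (addrK 1 i)) => i.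
move: (addrK _ _); move: (i - 1 + 1) (subrK 1 i) => k -> e.
by rewrite (eq_irrelevance e erefl).
Qed.

(** If [s] contracts [L] and [p] is a retraction in each degree, then [h = s p]
    makes [d h + h d] a chain map from [M] to [L], and on [L] it equals
    [d s + s d], the identity. *)
Lemma contractible_retract (L M : chain_complex R) (f : chain_map L M) :
    contractible L ->
    (forall i, exists r : {linear M i -> L i}, forall x, r (f i x) = x) ->
  exists r : chain_map M L, forall i x, r i (f i x) = x.
Proof.
move=> [s sE] ret; have [p pE] := all_sig (fun i => cid (ret i)).
pose h i : {linear M (i - 1) -> L i} := s i \o p (i - 1).
pose t i : {linear M (i - 1) -> L (i - 1)} :=
  (diff L i \o h i) \+ (h (i - 1) \o diff M (i - 1)).
have [r rE] := shift_family (P := fun i => {linear M i -> L i}) t.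
have shift (Q : int -> Prop) : (forall i, Q (i - 1)) -> forall i, Q i.
  by move=> Qt; have [] := shift_family Qt.
have r_comm i (x : M i) : r (i - 1) (diff M i x) = diff L i (r i x).
  move: i x; apply: shift => i x.
  by rewrite !rE /= !diffK !linear0 addr0 linearD diffK add0r.
exists (ChainMap r_comm); apply: shift => i x /=.
by rewrite rE /= -cm_comm !pE -sE.
Qed.

Lemma contractible_pure_acyclic (N : chain_complex R) :
  contractible N -> pure_acyclic N.
Proof.
move=> [s sE]; have ac : acyclic N.
  by move=> i x dx; exists (s i x); rewrite [RHS](sE i x) /= dx linear0 addr0.
split=> // i.
apply: (split_pure_exact (s := s i \o subm_incl (cycles N (i - 1)))).
  split=> [|y|z]; first exact: val_inj.
    split=> [/(congr1 val)/= dy|[x <-]]; last first.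
      by apply: val_inj; apply/eqP; exact: (valP x).
    have cy : y \in cycles N i by apply/eqP.
    by exists (exist _ y cy).
  have [|y yE] := ac i (val z); first by apply/eqP; exact: (valP z).
  by exists y; apply: val_inj.
move=> z; apply: val_inj; rewrite /= [RHS](sE i (val z)) /=.
by rewrite (eqP (valP z : diff N _ _ == 0)) linear0 addr0.
Qed.

Lemma split_pure_subcomplex (M : chain_complex R) (L : subcomplex M) :
  split_subcomplex L -> pure_subcomplex L.
Proof.
move=> [ex [r rE]]; split=> // A _ _; split.
- by move=> u v fuv i x; apply: val_inj; exact: fuv.
- move=> v; split=> [gv0|[u fu] i x]; last first.
    by have [_ fg _] := ex i; apply/fg; exists (u i x); exact: fu.
  have uc i (x : A i) :
      (r (i - 1) \o v (i - 1)) (diff A i x) = diff (sub_cx L) i ((r i \o v i) x).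
    by rewrite /= !cm_comm.
  exists (ChainMap (cm_fun := fun i => r i \o v i) uc) => i x /=.
  have [_ fg _] := ex i.
  by have /fg[y <-] := gv0 i x; rewrite rE.
- move=> w.
  have sec i : exists s : {linear quot_mod (L i) -> M i},
      forall x, s (quot_pi (L i) x) = x - sub_incl L i (r i x).
    apply: (factor_epi (g := quot_pi (L i))
      (f := idfun \- (sub_incl L i \o r i))).
      by have [_ _] := ex i.
    by have [_ fg _] := ex i => x /fg[y <-]; rewrite /= rE subrr.
  have [s sE] := all_sig (fun i => cid (sec i)).
  have sc i q : s (i - 1) (diff (quot_cx L) i q) = diff M i (s i q).
    have [_ _ /(_ q)[x <-]] := ex i.
    rewrite -[diff (quot_cx L) i _](cm_comm (quot_proj L)) !sE linearB.
    by rewrite (cm_comm r) (cm_comm (sub_incl L)).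
  have gs i q : quot_proj L i (s i q) = q.
    have [_ fg /(_ q)[x <-]] := ex i; rewrite sE linearB.
    have -> : quot_proj L i (sub_incl L i (r i x)) = 0.
      by apply/fg; exists (r i x).
    by rewrite subr0.
  have vc i (x : A i) :
      (s (i - 1) \o w (i - 1)) (diff A i x) = diff M i ((s i \o w i) x).
    by rewrite /= cm_comm sc.
  by exists (ChainMap (cm_fun := fun i => s i \o w i) vc) => i x /=; exact: gs.
Qed.

(** * Split pure sequences *)

(** Classes of modules to which the complexes of the theorem belong in each
    degree.  Closure under direct summands passes from [M i] to the pure
    submodules of [M i]. *)
Definition pure_split_class (C : lmodType R -> Prop) : Prop :=
  (forall K P (f : {linear K -> P}) (r : {linear P -> K}),
     (forall x, r (f x) = x) -> C P -> C K) /\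
  (forall K P N (f : {linear K -> P}) (g : {linear P -> N}),
     C P -> pure_exact f g -> exists s : {linear N -> P}, forall z, g (s z) = z).

(** Purity is used twice: first for [L] in [M], in each degree, which makes
    [L i] a direct summand of [M i] and hence a member of [C], and then for the
    cycles in [L i], which makes [L] contractible. *)
Lemma pure_split_class_pure_acyclic (C : lmodType R -> Prop)
    (M : chain_complex R) (L : subcomplex M) :
    pure_split_class C -> (forall i, C (M i)) ->
    pure_acyclic (sub_cx L) -> pure_subcomplex L ->
  contractible (sub_cx L) /\ split_subcomplex L.
Proof.
move=> [C_retract C_split] CM [_ Lpac] Lpure.
have Lret i : exists r : {linear M i -> subm_type (L i)},
    forall x, r (subm_incl (L i) x) = x.
  have ex := pure_subcomplex_degree i Lpure.
  have [s sE] := C_split _ _ _ _ _ (CM i) ex.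
  exact: (retraction_of_section (proj1 ex) sE).
have Lcontr : contractible (sub_cx L).
  apply: contractible_of_sections => i; apply: C_split (Lpac i).
  by have [r rE] := Lret i; apply: C_retract rE (CM i).
split=> //; split; first by move=> i; exact: short_exact_sub_quot.
exact: (contractible_retract (f := sub_incl L)).
Qed.

Lemma injective_module_retract K P (f : {linear K -> P})
    (r : {linear P -> K}) :
  (forall x, r (f x) = x) -> injective_module P -> injective_module K.
Proof.
move=> rK P_inj B C i h i_inj.
have [e eE] := P_inj _ _ i (f \o h) i_inj.
by exists (r \o e) => x; rewrite /= eE /= rK.
Qed.

Lemma projective_retract K P (f : {linear K -> P})
    (r : {linear P -> K}) :
  (forall x, r (f x) = x) -> projective P -> projective K.
Proof.
move=> rK P_proj B C g h g_surj.
have [e eE] := P_proj _ _ g (h \o r) g_surj.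
by exists (e \o f) => x; rewrite /= eE /= rK.
Qed.

Lemma finitely_generated_epi P N (g : {linear P -> N}) :
    (forall z, exists x, g x = z) -> finitely_generated P ->
  finitely_generated N.
Proof.
move=> g_surj [n [e eP]]; exists n, (g \o e) => z; have [x <-] := g_surj z.
have [c ->] := eP x; exists c; rewrite linear_sum.
by apply: eq_bigr => i _; rewrite linearZ.
Qed.

Lemma finitely_generated_retract K P (f : {linear K -> P})
    (r : {linear P -> K}) :
  (forall x, r (f x) = x) -> finitely_generated P -> finitely_generated K.
Proof. by move=> rK; apply: finitely_generated_epi => z; exists (f z). Qed.

Lemma noetherian_injective_class :
  left_noetherian R -> pure_split_class (@injective_module R).
Proof.
move=> noeth; split=> [K P f r|K P N f g P_inj ex].
  exact: injective_module_retract.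
have [r rE] := pure_injective_retraction noeth P_inj ex.
exact: section_of_retraction (proj1 ex) rE.
Qed.

Lemma perfect_projective_class :
  left_perfect R -> pure_split_class (@projective R).
Proof.
move=> perf; split=> [K P f r|K P N f g P_proj]; first exact: projective_retract.
exact: projective_cover_split.
Qed.

Lemma semi_perfect_projective_class : semi_perfect R ->
  pure_split_class (fun P => @finitely_generated R P /\ @projective R P).
Proof.
move=> perf; split=> [K P f r rK [P_fg P_proj]|K P N f g [P_fg P_proj] ex].
  split; first exact: finitely_generated_retract rK P_fg.
  exact: projective_retract rK P_proj.
apply: (projective_cover_split P_proj _ ex); apply: perf.
by have [[_ _ g_surj] _] := ex; exact: finitely_generated_epi g_surj P_fg.
Qed.

Lemma noetherian_fg_class :
  left_noetherian R -> pure_split_class (@finitely_generated R).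
Proof.
move=> noeth; split=> [K P f r|K P N f g P_fg ex].
  exact: finitely_generated_retract.
apply: (noetherian_fg_split noeth _ ex).
by have [[_ _ g_surj] _] := ex; exact: finitely_generated_epi g_surj P_fg.
Qed.

End Complexes.

Theorem mainTheorem2 (R : pzRingType) (M : chain_complex R)
  (hM : (left_noetherian R /\ forall i : int, injective_module (M i))
     \/ (left_perfect R /\ forall i : int, projective (M i))
     \/ (semi_perfect R /\
         forall i : int, finitely_generated (M i) /\ projective (M i))
     \/ (left_noetherian R /\
         forall i : int, finitely_generated (M i) /\ projective (M i))) :
  (forall L : subcomplex M,
     pure_acyclic (sub_cx L) -> pure_subcomplex L ->
     contractible (sub_cx L) /\ split_subcomplex L)
  /\ (split_minimal M <-> pure_minimal M).
Proof.
have main (L : subcomplex M) : pure_acyclic (sub_cx L) -> pure_subcomplex L ->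
    contractible (sub_cx L) /\ split_subcomplex L.
  case: hM => [[noeth CM]|[[perf CM]|[[perf CM]|[noeth CM]]]].
  - exact: pure_split_class_pure_acyclic (noetherian_injective_class noeth) CM.
  - exact: pure_split_class_pure_acyclic (perfect_projective_class perf) CM.
  - exact: pure_split_class_pure_acyclic (semi_perfect_projective_class perf) CM.
  - apply: pure_split_class_pure_acyclic (noetherian_fg_class noeth) _.
    by move=> i; case: (CM i).
split=> //; split=> [Mmin L Lpac Lpure|Mmin L Lcontr Lsplit].
  by have [Lcontr Lsplit] := main L Lpac Lpure; exact: Mmin.
apply: Mmin; first exact: contractible_pure_acyclic.
exact: split_pure_subcomplex.
Qed.
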